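(* Let $\mathbb{F}=\mathbb{R}$ or $\mathbb{F}=\mathbb{C}$, let $\Omega\subset[n_1]\times[n_2]\times[n_3]$ be nonempty, and let $Q_{ijk}\in\mathbb{F}\setminus\{0\}$ for $(i,j,k)\in\Omega$. Let $a\in\mathbb{F}^{n_1}$, $b\in\mathbb{F}^{n_2}$, $c\in\mathbb{F}^{n_3}$ with $a_1=1$, $b_1=1$ be a rank one solution, i.e. $Q_{ijk}=a_ib_jc_k$ for all $(i,j,k)\in\Omega$. Then the rank one solution $(a,b,c)$ is locally unique if and only if the homogeneous real linear system $$x_1=0,\quad y_1=0,\quad x_i+y_j+z_k=0,\ (i,j,k)\in\Omega,$$ in the unknowns $x\in\mathbb{R}^{n_1}$, $y\in\mathbb{R}^{n_2}$, $z\in\mathbb{R}^{n_3}$ has only the zero solution.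
   Context: Here $[n]=\{1,\dots,n\}$. Given observed values $Q_{ijk}$, $(i,j,k)\in\Omega$, the rank one tensor completion problem asks for vectors $a\in\mathbb{F}^{n_1}$, $b\in\mathbb{F}^{n_2}$, $c\in\mathbb{F}^{n_3}$ such that the tensor $a\circ b\circ c$, with entries $[a\circ b\circ c]_{ijk}=a_ib_jc_k$, agrees with $Q$ on $\Omega$. Since $(a,b,c)$ is determined by the tensor only up to rescaling $(\lambda_1a,\lambda_2b,\lambda_3c)$ with $\lambda_1\lambda_2\lambda_3=1$, solutions are normalized by $a_1=1$, $b_1=1$. A normalized solution $(a,b,c)$ is called locally unique if it is unique up to sufficiently small perturbations, i.e. there is a neighborhood of $(a,b,c)$ in $\mathbb{F}^{n_1}\times\mathbb{F}^{n_2}\times\mathbb{F}^{n_3}$ containing no other triple $(a',b',c')$ with $a'_1=b'_1=1$ and $Q_{ijk}=a'_ib'_jc'_k$ for all $(i,j,k)\in\Omega$. *)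

(* Defs.v *)
From HB Require Import structures.
From mathcomp Require Import all_boot all_order all_algebra.
From mathcomp Require Import complex.
From mathcomp Require Import all_classical all_reals all_analysis.

Set Implicit Arguments.
Unset Strict Implicit.
Unset Printing Implicit Defensive.

Import Order.TTheory GRing.Theory Num.Theory.
Import numFieldNormedType.Exports.

Local Open Scope classical_set_scope.
Local Open Scope ring_scope.

(* The first dimensions are written n1.+1 and n2.+1 because the normalization
   refers to the coordinates a_1 and b_1, which are a 0 0 and b 0 0 here. *)

Definition rank1_tensor (K : numFieldType) (n1 n2 n3 : nat)
    (a : 'rV[K]_n1) (b : 'rV[K]_n2) (c : 'rV[K]_n3) :
    'I_n1 -> 'I_n2 -> 'I_n3 -> K :=
  fun i j k => a 0 i * b 0 j * c 0 k.

Definition rank1_solution (K : numFieldType) (n1 n2 n3 : nat)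
    (Omega : {set 'I_n1.+1 * 'I_n2.+1 * 'I_n3})
    (Q : 'I_n1.+1 -> 'I_n2.+1 -> 'I_n3 -> K)
    (a : 'rV[K]_n1.+1) (b : 'rV[K]_n2.+1) (c : 'rV[K]_n3) : Prop :=
  [/\ a 0 0 = 1, b 0 0 = 1 &
      forall i j k, (i, j, k) \in Omega -> Q i j k = rank1_tensor a b c i j k].

Definition locally_unique (K : numFieldType) (n1 n2 n3 : nat)
    (Omega : {set 'I_n1.+1 * 'I_n2.+1 * 'I_n3})
    (Q : 'I_n1.+1 -> 'I_n2.+1 -> 'I_n3 -> K)
    (a : 'rV[K]_n1.+1) (b : 'rV[K]_n2.+1) (c : 'rV[K]_n3) : Prop :=
  exists2 U : set ('rV[K]_n1.+1 * 'rV[K]_n2.+1 * 'rV[K]_n3),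
    nbhs (a, b, c) U &
    forall a' b' c', U (a', b', c') -> rank1_solution Omega Q a' b' c' ->
      (a', b', c') = (a, b, c).

Definition only_zero_solution (R : realType) (n1 n2 n3 : nat)
    (Omega : {set 'I_n1.+1 * 'I_n2.+1 * 'I_n3}) : Prop :=
  forall (x : 'rV[R]_n1.+1) (y : 'rV[R]_n2.+1) (z : 'rV[R]_n3),
    x 0 0 = 0 -> y 0 0 = 0 ->
    (forall i j k, (i, j, k) \in Omega -> x 0 i + y 0 j + z 0 k = 0) ->
    [/\ x = 0, y = 0 & z = 0].

(* Main.v *)
(* A kernel vector (x, y, z) of the linear system yields the one-parameter family
   of solutions (a_i e^(t x_i), b_j e^(t y_j), c_k e^(t z_k)), so local uniqueness
   forces x = y = z = 0.  Conversely, write the ratios of a nearby solution to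
   (a, b, c) as 1 + p, 1 + q, 1 + r.  Expanding (1 + p_i)(1 + q_j)(1 + r_k) = 1
   shows that the linear system holds for (p, q, r) up to an error quadratic in
   its size s, and a left inverse of the system gives s <= C s^2, hence s = 0
   for small s.  The left inverse is real, so the same argument works over the
   complex numbers, without logarithms. *)

Require Import Defs.
From HB Require Import structures.
From mathcomp Require Import all_boot all_order all_algebra.
From mathcomp Require Import complex.
From mathcomp Require Import all_classical all_reals all_analysis.
From mathcomp Require Import ring.

Set Implicit Arguments.
Unset Strict Implicit.
Unset Printing Implicit Defensive.

Import Order.TTheory GRing.Theory Num.Theory.
Import numFieldNormedType.Exports.

Local Open Scope classical_set_scope.
Local Open Scope ring_scope.

(** * Left inverses and quadratic estimates *)

Lemma injective_system_left_inverse (F : fieldType) (V E : finType) (A : V -> E -> F) :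
  (forall x : V -> F, (forall e, \sum_v x v * A v e = 0) -> forall v, x v = 0) ->
  exists B : E -> V -> F, forall v w, \sum_e A v e * B e w = (v == w)%:R.
Proof.
move=> A_inj; pose M := \matrix_(i < #|V|, j < #|E|) A (enum_val i) (enum_val j).
(* Unknowns index the rows and vectors act from the left, so a trivial kernel means full row rank,
   which provides a right inverse [N] of [M]. *)
have /row_freeP[N MN] : row_free M.
  apply: inj_row_free => u uM0; apply/rowP => i; rewrite mxE.
  rewrite -(enum_valK i); apply: (A_inj (fun v => u 0 (enum_rank v))) => e.
  rewrite (reindex _ (onW_bij _ (@enum_val_bij V))) /=.
  have /rowP/(_ (enum_rank e)) := uM0; rewrite !mxE => uMe.
  by rewrite -[RHS]uMe; apply: eq_bigr => j _; rewrite enum_valK mxE enum_rankK.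
exists (fun e v => N (enum_rank e) (enum_rank v)) => v w.
rewrite (reindex _ (onW_bij _ (@enum_val_bij E))) /=.
have /matrixP/(_ (enum_rank v) (enum_rank w)) := MN.
rewrite !mxE (inj_eq enum_rank_inj) => <-.
by apply: eq_bigr => j _; rewrite enum_valK mxE enum_rankK.
Qed.

Lemma quadratic_bound_eq0 (K : numFieldType) (C s : K) :
  0 <= s -> s * C < 1 -> s <= s ^+ 2 * C -> s = 0.
Proof.
move=> s_ge0 sC; rewrite expr2 -mulrA => s_le.
apply/eqP; rewrite eq_le s_ge0 andbT -(pmulr_lle0 (x := 1 - s * C)) ?subr_gt0//.
by rewrite mulrBr mulr1 subr_le0.
Qed.

(** Expanding the product and cancelling 1 leaves three pairwise products and one triple product.
    Each is at most [s ^+ 2], the triple one because [s <= 1]; hence the factor 4. *)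
Lemma le_quadratic_of_mul1 (K : numFieldType) (p q r s : K) :
  `|p| <= s -> `|q| <= s -> `|r| <= s -> s <= 1 ->
  (1 + p) * (1 + q) * (1 + r) = 1 -> `|p + q + r| <= s ^+ 2 * 4.
Proof.
move=> ps qs rs s1 h.
have s0 : 0 <= s by apply: le_trans ps.
have -> : p + q + r = - (p * q + p * r + q * r + p * q * r).
  apply/subr0_eq; transitivity ((1 + p) * (1 + q) * (1 + r) - 1); first ring.
  by rewrite h subrr.
have -> : s ^+ 2 * 4 = s * s + s * s + s * s + s * s * 1 by ring.
have sM x y : `|x| <= s -> `|y| <= s -> `|x * y| <= s * s.
  by move=> xs ys; rewrite normrM ler_pM.
rewrite normrN (le_trans (ler_normD _ _))// lerD//; last first.
  by rewrite normrM ler_pM ?sM ?(le_trans rs).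
rewrite (le_trans (ler_normD _ _))// lerD ?sM//.
by rewrite (le_trans (ler_normD _ _))// lerD ?sM.
Qed.

(** * The linear system as a matrix *)

Section Unknowns.
Variables n1 n2 n3 : nat.
Implicit Types (Omega : {set 'I_n1.+1 * 'I_n2.+1 * 'I_n3}).

Definition unknown : finType := ('I_n1.+1 + 'I_n2.+1 + 'I_n3)%type.
Definition ux (i : 'I_n1.+1) : unknown := inl (inl i).
Definition uy (j : 'I_n2.+1) : unknown := inl (inr j).
Definition uz (k : 'I_n3) : unknown := inr k.

Definition unknown_val (T : Type) (a : 'rV[T]_n1.+1) (b : 'rV[T]_n2.+1)
    (c : 'rV[T]_n3) (v : unknown) : T :=
  match v with inl (inl i) => a 0 i | inl (inr j) => b 0 j | inr k => c 0 k end.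

(* [None] and [Some None] index the normalizations [x_1 = 0] and [y_1 = 0];
   triples outside Omega index the trivial equation [0 = 0]. *)
Definition equation : finType :=
  option (option ('I_n1.+1 * 'I_n2.+1 * 'I_n3)%type).

(** The ring is a parameter because the same 0-1 coefficients serve over [R], to invert the system,
    and over [K], to estimate residuals. *)
Definition system_coef Omega (F : pzSemiRingType) (v : unknown) (e : equation) : F :=
  match e with
  | None => (v == ux 0)%:R
  | Some None => (v == uy 0)%:R
  | Some (Some t) => if t \in Omega
      then (v == ux t.1.1)%:R + (v == uy t.1.2)%:R + (v == uz t.2)%:R else 0
  end.

Lemma sum_delta (F : pzSemiRingType) (x : unknown -> F) w :
  \sum_v x v * (v == w)%:R = x w.
Proof.
rewrite (bigD1 w)//= eqxx mulr1 big1 ?addr0// => v /negPf ->.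
by rewrite mulr0.
Qed.

Lemma sum_system_coef Omega (F : pzSemiRingType) (x : unknown -> F) e :
  \sum_v x v * system_coef Omega F v e =
  match e with
  | None => x (ux 0)
  | Some None => x (uy 0)
  | Some (Some t) => if t \in Omega
      then x (ux t.1.1) + x (uy t.1.2) + x (uz t.2) else 0
  end.
Proof.
case: e => [[t|]|] /=; rewrite ?sum_delta//.
case: ifP => _; last by rewrite big1 // => v _; rewrite mulr0.
under eq_bigr do rewrite !mulrDr.
by rewrite !big_split /= !sum_delta.
Qed.

Lemma only_zero_solutionP Omega (R : realType) :
  only_zero_solution R Omega ->
  forall x : unknown -> R, x (ux 0) = 0 -> x (uy 0) = 0 ->
    (forall i j k, (i, j, k) \in Omega -> x (ux i) + x (uy j) + x (uz k) = 0) ->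
    forall v, x v = 0.
Proof.
move=> only0 x x0 y0 xyz.
have [||i j k ijk|] := only0 (\row_i x (ux i)) (\row_j x (uy j)) (\row_k x (uz k)).
- by rewrite mxE.
- by rewrite mxE.
- by rewrite !mxE xyz.
move=> /rowP xE /rowP yE /rowP zE [[i|j]|k].
- by have := xE i; rewrite !mxE.
- by have := yE j; rewrite !mxE.
- by have := zE k; rewrite !mxE.
Qed.

End Unknowns.

(** * Perturbation curves with real exponents *)

Section ScalarExtension.
Variables (R : realType) (K : numFieldType) (iota : {rmorphism R -> K}).
(** Commuting with norms makes [iota] monotone, since a nonnegative real is its own norm. Cofinality
    puts a real radius below every positive element of [K]. *)
Hypothesis norm_iota : forall r, `|iota r| = iota `|r|.
Hypothesis iota_cofinal : forall e : K, 0 < e -> exists2 r : R, 0 < r & iota r <= e.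

Let ler_iota (r s : R) : r <= s -> iota r <= iota s.
Proof.
by rewrite -subr_ge0 => /ger0_norm h; rewrite -subr_ge0 -rmorphB -h -norm_iota.
Qed.

Let ltr_iota (r s : R) : r < s -> iota r < iota s.
Proof. by rewrite !lt_neqAle fmorph_eq => /andP[-> /ler_iota]. Qed.

(* A zero coordinate belongs to no triple of Omega and can be moved additively;
   a multiplicative perturbation would leave it fixed. *)
Definition log_shift (t : R) (a : K) (x : R) : K :=
  if a == 0 then iota (t * x) else a * iota (expR (t * x)).

Lemma log_shift0 t a : log_shift t a 0 = a.
Proof.
by rewrite /log_shift mulr0 expR0 rmorph0 rmorph1 mulr1; case: eqP.
Qed.

Lemma log_shift_fixed t a x : t != 0 -> log_shift t a x = a -> x = 0.
Proof.
move=> t0; rewrite /log_shift; case: eqP => [->|/eqP a0].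
  by move=> /eqP; rewrite fmorph_eq0 mulf_eq0 (negPf t0) => /eqP.
move=> /eqP; rewrite -{2}[a]mulr1 (inj_eq (mulfI a0)) fmorph_eq1 -expR0.
by move=> /eqP/expR_inj/eqP; rewrite mulf_eq0 (negPf t0) => /eqP.
Qed.

(** A nonzero product puts all three factors in the multiplicative case, where the exponentials
    combine to the exponential of [t * (x + y + z)], which is 1. *)
Lemma log_shiftM t a b c x y z : a * b * c != 0 -> x + y + z = 0 ->
  log_shift t a x * log_shift t b y * log_shift t c z = a * b * c.
Proof.
rewrite !mulf_eq0 !negb_or -andbA => /and3P[/negPf a0 /negPf b0 /negPf c0] xyz.
rewrite /log_shift a0 b0 c0.
rewrite [LHS](_ : _ = a * b * c * iota (expR (t * (x + y + z)))).
  by rewrite xyz mulr0 expR0 rmorph1 mulr1.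
rewrite !mulrDr !expRD !rmorphM /=; ring.
Qed.

Lemma near_iota_lt (f : R -> R) (a e : K) : 0 < e -> f x @[x --> 0] --> (0:R) ->
  \forall t \near (0 : R), `|a * iota (f t)| < e.
Proof.
move=> e0 f0.
(* Dividing by [1 + |a|] instead of [|a|] covers [a = 0]. *)
have a1 : 0 < 1 + `|a| by rewrite ltr_pwDl.
have [r r0 re] := iota_cofinal (divr_gt0 e0 a1).
have /cvgr0Pnorm_lt/(_ r r0) := f0; apply: filterS => t ft.
rewrite normrM norm_iota (@le_lt_trans _ _ ((1 + `|a|) * iota `|f t|))//.
  by rewrite ler_wpM2r ?lerDr// -norm_iota.
by rewrite mulrC -ltr_pdivlMr// (lt_le_trans _ re)// ltr_iota.
Qed.

Lemma near_log_shift a x (e : K) : 0 < e ->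
  \forall t \near (0 : R), `|a - log_shift t a x| < e.
Proof.
move=> e0; have tx0 : t * x @[t --> 0] --> (0:R).
  by rewrite -[X in _ --> X](mul0r x); apply: cvgMr_tmp; exact: cvg_id.
rewrite /log_shift; case: eqP => [->|_].
  have := near_iota_lt 1 e0 tx0; apply: filterS => t.
  by rewrite sub0r normrN mul1r.
have ex0 : (1 - expR (t * x)) @[t --> 0] --> (0:R).
  have := cvgB (cvg_cst (1 : R)) (cvg_comp _ _ tx0 (@continuous_expR R 0)).
  rewrite expR0 subrr; exact.
have := near_iota_lt a e0 ex0; apply: filterS => t.
by rewrite rmorphB rmorph1 mulrBr mulr1.
Qed.

(** * The two implications over [K] *)

Variables (n1 n2 n3 : nat) (Omega : {set 'I_n1.+1 * 'I_n2.+1 * 'I_n3}).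
Variables (Q : 'I_n1.+1 -> 'I_n2.+1 -> 'I_n3 -> K).
Variables (a : 'rV[K]_n1.+1) (b : 'rV[K]_n2.+1) (c : 'rV[K]_n3).
Hypothesis Q_neq0 : forall i j k, (i, j, k) \in Omega -> Q i j k != 0.
Hypothesis sol_abc : rank1_solution Omega Q a b c.

Lemma near_log_shift_row m (u : 'rV[K]_m) (x : 'rV[R]_m) (e : K) : 0 < e ->
  \forall t \near (0 : R), ball u e (\row_i log_shift t (u 0 i) (x 0 i)).
Proof.
move=> e0.
have := filter_forall (nbhs_filter (0 : R))
  (fun i => near_log_shift (u 0 i) (x 0 i) e0).
apply: filterS => t ut; split=> // i j; rewrite ord1 mxE -ball_normE /=; exact: ut.
Qed.

Lemma locally_unique_only_zero : locally_unique Omega Q a b c -> only_zero_solution R Omega.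
Proof.
have [a0 b0 abc] := sol_abc.
move=> [U /nbhs_ballP[e /= e0 eU] U_uniq] x y z x0 y0 xyz.
(* The punctured filter is proper, so some nonzero [t] keeps the curve inside [U]. *)
have : \forall t \near (0:R)^', t != 0 /\ U (\row_i log_shift t (a 0 i) (x 0 i),
    \row_i log_shift t (b 0 i) (y 0 i), \row_i log_shift t (c 0 i) (z 0 i)).
  near=> t; split; first by near: t; exact: nbhs_dnbhs_neq.
  apply: eU; split; first split; near: t; apply: nbhs_dnbhs;
    exact: near_log_shift_row.
move=> /filter_ex[t [t0 Ut]].
have /(U_uniq _ _ _ Ut)[/rowP aE /rowP bE /rowP cE] : rank1_solution Omega Q
    (\row_i log_shift t (a 0 i) (x 0 i)) (\row_i log_shift t (b 0 i) (y 0 i))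
    (\row_i log_shift t (c 0 i) (z 0 i)).
  split; rewrite ?mxE ?x0 ?y0 ?log_shift0// => i j k ijk.
  rewrite abc// /rank1_tensor !mxE log_shiftM ?xyz//.
  by have := Q_neq0 ijk; rewrite abc.
split; apply/rowP => i; rewrite [RHS]mxE.
- by have := aE i; rewrite mxE => /(log_shift_fixed t0).
- by have := bE i; rewrite mxE => /(log_shift_fixed t0).
- by have := cE i; rewrite mxE => /(log_shift_fixed t0).
Unshelve. all: by end_near. Qed.

(** The indicator of a vanishing coordinate would be a nonzero kernel vector: that coordinate is not
    a normalized one, and it lies in no triple of [Omega] because [Q] is nonzero there. *)
Lemma only_zero_solution_neq0 : only_zero_solution R Omega ->
  forall v, unknown_val a b c v != 0.
Proof.
have [a0 b0 abc] := sol_abc.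
move=> /only_zero_solutionP only0 v; apply/negP => v0.
have vE w : unknown_val a b c w != 0 -> (w == v) = false.
  by apply: contra_neqF => /eqP ->; exact/eqP.
suff H : forall w, (w == v)%:R = 0 :> R by have /eqP := H v; rewrite eqxx oner_eq0.
apply: only0 => [||i j k ijk].
- by rewrite vE//= a0 oner_neq0.
- by rewrite vE//= b0 oner_neq0.
have := Q_neq0 ijk; rewrite abc// /rank1_tensor !mulf_eq0 !negb_or -andbA.
by case/and3P=> ai bj ck; rewrite !vE// !addr0.
Qed.

Lemma only_zero_locally_unique : only_zero_solution R Omega -> locally_unique Omega Q a b c.
Proof.
have [a0 b0 abc] := sol_abc.
move=> only0; have v0 := only_zero_solution_neq0 only0.
set al := unknown_val a b c in v0.
have [B AB] : exists B : equation n1 n2 n3 -> unknown n1 n2 n3 -> R,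
    forall v w, \sum_e system_coef Omega R v e * B e w = (v == w)%:R.
  apply: injective_system_left_inverse => x xA.
  apply: (only_zero_solutionP only0) => [||i j k ijk].
  - by have := xA None; rewrite sum_system_coef.
  - by have := xA (Some None); rewrite sum_system_coef.
  - by have := xA (Some (Some (i, j, k))); rewrite sum_system_coef ijk.
(* [C] gathers the constant 4 of the residual bound and the entries of [B]; [W] converts coordinate
   distances into ratio errors. *)
pose C : K := \sum_w 4 * \sum_e `|iota (B e w)|.
pose W : K := \sum_v `|al v|^-1.
have C0 : 0 <= C by apply: sumr_ge0 => w _; rewrite mulr_ge0// sumr_ge0.
have W0 : 0 <= W by apply: sumr_ge0 => w _; rewrite invr_ge0.
have C1 : 0 < 1 + C by rewrite ltr_pwDl.
have W1 : 0 < 1 + W by rewrite ltr_pwDl.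
(* With this radius, [s * (1 + C) <= W / (1 + W) < 1], which yields both [s <= 1] and
   [s * C < 1]. *)
pose eps := ((1 + C) * (1 + W))^-1.
have eps0 : 0 < eps by rewrite invr_gt0 mulr_gt0.
exists (ball (a, b, c) eps); first exact: nbhsx_ballx.
move=> a' b' c' [[/= ba bb] bc] [a'0 b'0 abc'].
pose be := unknown_val a' b' c'.
have al_be v : `|al v - be v| < eps.
  case: v => [[i|j]|k] /=.
  - by have := ba.2 0 i; rewrite -ball_normE.
  - by have := bb.2 0 j; rewrite -ball_normE.
  - by have := bc.2 0 k; rewrite -ball_normE.
pose p v := be v / al v - 1.
pose s := \sum_v `|p v|.
have ps v : `|p v| <= s.
  by rewrite /s (bigD1 v)//= lerDl sumr_ge0.
have s0 : 0 <= s by apply: sumr_ge0.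
have sW : s <= eps * W.
  rewrite /s /W mulr_sumr; apply: ler_sum => v _.
  have -> : p v = (be v - al v) / al v by rewrite /p mulrBl divff ?v0.
  by rewrite normrM normfV ler_wpM2r ?invr_ge0// distrC ltW.
have sC1 : s * (1 + C) < 1.
  rewrite (@le_lt_trans _ _ (eps * W * (1 + C)))// ?ler_wpM2r// ?ltW//.
  rewrite /eps -mulrA mulrC ltr_pdivrMr ?mulr_gt0// mul1r mulrC ltr_pM2l//.
  by rewrite ltrDr.
have s1 : s <= 1.
  by rewrite ltW// (le_lt_trans _ sC1)// ler_peMr// lerDl.
have sC : s * C < 1.
  by rewrite (le_lt_trans _ sC1)// ler_wpM2l// lerDr.
(* [B] recovers [p] from its residuals: the real identity [AB] is carried to [K] by [iota], which
   fixes the natural-number coefficients. *)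
have pE w : p w = \sum_e (\sum_v p v * system_coef Omega K v e) * iota (B e w).
  under eq_bigr do rewrite mulr_suml.
  rewrite exchange_big /= -[LHS]sum_delta; apply: eq_bigr => v _.
  under eq_bigr do rewrite -mulrA.
  rewrite -mulr_sumr; congr (_ * _).
  rewrite -(rmorph_nat iota) -AB rmorph_sum; apply: eq_bigr => e _.
  rewrite rmorphM; congr (_ * _).
  case: e => [[t|]|] /=; rewrite ?rmorph_nat//.
  by case: ifP => _; rewrite ?rmorph0// !rmorphD !rmorph_nat.
have eqn e : `|\sum_v p v * system_coef Omega K v e| <= s ^+ 2 * 4.
  have s4 : 0 <= s ^+ 2 * 4 by rewrite mulr_ge0// exprn_ge0.
  rewrite sum_system_coef; case: e => [[[[i j] k]|]|]; last 2 first.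
  - by rewrite /p /be /al /= b0 b'0 divr1 subrr normr0.
  - by rewrite /p /be /al /= a0 a'0 divr1 subrr normr0.
  case: ifPn => [ijk|_]; last by rewrite normr0.
  apply: le_quadratic_of_mul1 => //=.
  rewrite /p !(addrC 1) !subrK /= !mulf_div.
  have := abc' _ _ _ ijk; rewrite abc// /rank1_tensor => E.
  rewrite /be/al/= -E divff//; have := Q_neq0 ijk; rewrite abc//.
have : s = 0.
  apply: (quadratic_bound_eq0 s0 sC).
  rewrite {1}/s /C mulr_sumr; apply: ler_sum => w _.
  rewrite pE mulrA mulr_sumr (le_trans (ler_norm_sum _ _ _))//.
  by apply: ler_sum => e _; rewrite normrM ler_wpM2r.
move=> s_eq0; have E v : be v = al v.
  have := ps v; rewrite s_eq0 normr_le0 subr_eq0 => /eqP h.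
  by rewrite -[RHS]mul1r -h divfK.
congr (_, _, _); apply/rowP => i.
- exact: (E (ux _ _ i)).
- exact: (E (uy _ _ i)).
- exact: (E (uz _ _ i)).
Qed.

End ScalarExtension.

Theorem proposition2p1 (R : realType) (n1 n2 n3 : nat)
    (Omega : {set 'I_n1.+1 * 'I_n2.+1 * 'I_n3}) (Omega_neq0 : Omega != finset.set0) :
  (forall (Q : 'I_n1.+1 -> 'I_n2.+1 -> 'I_n3 -> R)
      (a : 'rV[R]_n1.+1) (b : 'rV[R]_n2.+1) (c : 'rV[R]_n3),
    (forall i j k, (i, j, k) \in Omega -> Q i j k != 0) ->
    rank1_solution Omega Q a b c ->
    (locally_unique Omega Q a b c <-> only_zero_solution R Omega))
  /\
  (forall (Q : 'I_n1.+1 -> 'I_n2.+1 -> 'I_n3 -> R[i])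
      (a : 'rV[R[i]]_n1.+1) (b : 'rV[R[i]]_n2.+1) (c : 'rV[R[i]]_n3),
    (forall i j k, (i, j, k) \in Omega -> Q i j k != 0) ->
    rank1_solution Omega Q a b c ->
    (locally_unique Omega Q a b c <-> only_zero_solution R Omega)).
Proof.
split=> Q a b c Q0 sol; split.
- by apply: (locally_unique_only_zero (iota := idfun) _ _ Q0 sol) => // e e0; exists e.
- by apply: (only_zero_locally_unique idfun Q0 sol).
- apply: (locally_unique_only_zero (iota := real_complex R) _ _ Q0 sol) => [r|e e0].
    by rewrite normc_def /= expr0n addr0 sqrtr_sqr.
  (* A positive element of [R[i]] has zero imaginary part, so its real part is the required
     radius. *)
  case: e e0 => x y; rewrite ltcE /= => /andP[/eqP y0 x0]; exists x => //.
  by rewrite lecE /= y0 eqxx lexx.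
- by apply: (only_zero_locally_unique (real_complex R) Q0 sol).
Qed.
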